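(* Let $D$ be a strongly connected digraph that is quasi-$3$-kernel-perfect. Let $x_0\in V(D)$. If every circuit $C$ of $D$ such that $|C|\not\equiv 0 \pmod 3$ has four short chords, then $D$ is $3$-kernel-perfect.
   Context: Digraphs are finite, loopless and without multiple (parallel) arcs; a pair of opposite arcs is allowed. $V(D)$ and $A(D)$ are the vertex and arc sets. All walks, paths, circuits and cycles are directed. A circuit is a closed directed trail (closed walk of positive length with no repeated arc; vertices may repeat); in particular every cycle is a circuit. $|C|$ is the length (number of arcs) of $C$. $D$ is strongly connected if for all $u,v\in V(D)$ there is a directed path from $u$ to $v$. A chord of a circuit $C$ is an arc $(a,b)\in A(D)$ with $a,b\in V(C)$ that is not in $A(C)$. Its length is the distance from $a$ to $b$ in $C$; a short chord is a chord of length two. $d_H(u,v)$ is the directed distance from $u$ to $v$ in a digraph $H$ ($\infty$ if there is no path). A $3$-kernel of a digraph $H$ is a set $N\subseteq V(H)$ such that $d_H(u,v)\ge 3$ for all distinct $u,v\in N$, and for every $u\in V(H)\setminus N$ there is $v\in N$ with $d_H(u,v)\le 2$. A digraph $D$ is quasi-$3$-kernel-perfect if every induced proper subdigraph of $D$ has a $3$-kernel, and $3$-kernel-perfect if every induced subdigraph of $D$ (including $D$ itself) has a $3$-kernel. The vertex $x_0$ is arbitrary and does not occur in the conclusion. *)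

(* Defs.v *)
From mathcomp Require Import all_boot.
Set Implicit Arguments.
Unset Strict Implicit.
Unset Printing Implicit Defensive.

(* A digraph D is a finite type T (its vertices) with an irreflexive arc
   relation e : rel T.  A subdigraph of D is a vertex set A : {set T} with an
   arc relation on T that only relates members of A; distances do not depend
   on the other, isolated, elements of T. *)

Section Digraph.
Variable T : finType.
Implicit Types (e : rel T) (A N : {set T}) (c : seq T) (u v : T).

Definition strongly_connected e : Prop := forall u v, connect e u v.

Definition has_dipath e u v (n : nat) : bool :=
  [exists p : n.-tuple T, [&& path e u p, last u p == v & uniq (u :: p)]].

(* None stands for infinity; a path has fewer than #|T| arcs, so the search
   range contains the lengths of all paths. *)
Definition dist e u v : option nat :=
  ohead [seq n <- iota 0 #|T| | has_dipath e u v n].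

Definition dist_le (d : option nat) (n : nat) : bool :=
  if d is Some m then m <= n else false.

Definition dist_ge (d : option nat) (n : nat) : bool :=
  if d is Some m then n <= m else true.

Definition induced e A : rel T := [rel x y | [&& x \in A, y \in A & e x y]].

(* Here (A, e) is the digraph of which N is a 3-kernel. *)
Definition is_3kernel A e N : Prop :=
  [/\ N \subset A,
      forall u v, u \in N -> v \in N -> u != v -> dist_ge (dist e u v) 3
    & forall u, u \in A :\: N ->
        exists2 v, v \in N & dist_le (dist e u v) 2].

Definition has_3kernel A e : Prop := exists N, is_3kernel A e N.

Definition quasi_3kernel_perfect e : Prop :=
  forall A, A \proper [set: T] -> has_3kernel A (induced e A).

Definition perfect_3kernel e : Prop :=
  forall A, has_3kernel A (induced e A).

(* The circuit x_0 -> x_1 -> ... -> x_(n-1) -> x_0 is encoded by the sequence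
   c = [:: x_0; ...; x_(n-1)], so that its length is size c; vertices may be
   repeated in c, arcs may not. *)
Definition circuit_arcs c : seq (T * T) := zip c (rot 1 c).

Definition circuit e c : bool :=
  [&& c != [::], cycle e c & uniq (circuit_arcs c)].

(* C as a subdigraph: distances in C may use the arcs of C in any order. *)
Definition circuit_rel c : rel T := [rel x y | (x, y) \in circuit_arcs c].

Definition chord e c (ab : T * T) : bool :=
  [&& e ab.1 ab.2, ab.1 \in c, ab.2 \in c & ab \notin circuit_arcs c].

Definition chord_length c (ab : T * T) : option nat :=
  dist (circuit_rel c) ab.1 ab.2.

Definition short_chords e c : {set T * T} :=
  [set ab | chord e c ab & chord_length c ab == Some 2].

End Digraph.

(* Main.v *)
Require Import Defs.
From mathcomp Require Import all_boot.
From mathcomp Require Import zify.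
Set Implicit Arguments.
Unset Strict Implicit.
Unset Printing Implicit Defensive.

(** The hypothesis on short chords is so strong that no circuit violates the
    congruence: every closed walk of [D] has length divisible by 3.  Indeed, let
    [C] be a shortest closed walk of length [n] not divisible by 3.  A repeated
    vertex would split [C] into two shorter closed walks, one of them again of
    length not divisible by 3; hence [C] is a cycle, and its short chords are
    arcs from a vertex to its second successor.  Replacing two consecutive arcs
    of [C] by the chord that spans them shortens [C] by 1.  If [n] is 2 modulo 3,
    one chord gives a closed walk of length [n - 1], congruent to 1.  If [n] is 1
    modulo 3, one can shorten along two chords that do not overlap, which gives
    length [n - 2], congruent to 2; four chords ensure that such a pair exists,
    since a given chord overlaps only the one starting at the next vertex and the
    one starting at the previous vertex.  Both cases contradict the minimality of
    [C] ([closed_walk_dvd3]).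

    The lengths of the walks from [x0] to a vertex [v] therefore have a common
    residue modulo 3, and this residue increases by 1 along each arc.  The
    vertices of residue 0 form a 3-kernel of [D] ([closed_walks_dvd3_has_3kernel]): a path
    between two of them has length divisible by 3, and from any vertex one reaches
    residue 0 in at most two steps along a path to [x0].  The proper induced
    subdigraphs have a 3-kernel because [D] is quasi-3-kernel-perfect. *)

Section Digraph.
Variable T : finType.
Implicit Types (r e : rel T) (c p q : seq T) (u v x y : T).

Lemma not_uniq_split c : ~~ uniq c ->
  exists x p1 p2 p3, c = p1 ++ x :: p2 ++ x :: p3.
Proof.
elim: c => // y c IH; rewrite /= negb_and negbK.
case/orP => [yc | /IH[x [p1 [p2 [p3 ->]]]]].
  by case/splitPr: yc => p2 p3; exists y, [::], p2, p3.
by exists x, (y :: p1), p2, p3.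
Qed.

Lemma cycle_split r x p q :
  cycle r (x :: p ++ x :: q) = cycle r (x :: p) && cycle r (x :: q).
Proof.
by rewrite /= -cats1 -catA /= cat_path /= !rcons_path cats1 rcons_path andbA.
Qed.

Lemma circuit_arcs_rel r c u v : cycle r c -> (u, v) \in circuit_arcs c -> r u v.
Proof.
rewrite /circuit_arcs; case: c => // x c; rewrite rot1_cons /=.
elim: c {1 3}x => [|y c IH] z /=; rewrite in_cons.
  by rewrite andbT orbF => rzx /eqP[-> ->].
by case/andP=> rzy cP /orP[/eqP[-> ->] // | /(IH _ cP)].
Qed.

Lemma cycle_circuit e c : c != [::] -> cycle e c -> uniq c -> circuit e c.
Proof. by move=> c0 cP Uc; rewrite /circuit c0 cP zip_uniql. Qed.

Lemma dist_has_dipath r u v n : dist r u v = Some n -> has_dipath r u v n.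
Proof.
rewrite /dist; set s := filter _ _ => sn.
suff: n \in s by rewrite mem_filter => /andP[].
by case: s sn => //= m s [->]; rewrite mem_head.
Qed.

Lemma dist_walk r u v n : dist r u v = Some n ->
  exists p, [/\ path r u p, last u p = v & size p = n].
Proof.
move/dist_has_dipath/existsP => [p /and3P[rp /eqP lp _]].
by exists p; rewrite size_tuple.
Qed.

Lemma dist_le_dipath r u v n : n < #|T| -> has_dipath r u v n ->
  dist_le (dist r u v) n.
Proof.
move=> ltnT run; rewrite /dist; set s := filter _ _.
have : sorted ltn s by apply: sorted_filter (iota_ltn_sorted _ _); apply: ltn_trans.
have : n \in s by rewrite mem_filter run mem_iota.
case: s => //= m s; rewrite in_cons => /orP[/eqP-> // | sn].
by move/(order_path_min ltn_trans)/allP/(_ n sn)/ltnW.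
Qed.

Lemma dist_le_walk r u p : path r u p ->
  dist_le (dist r u (last u p)) (size p).
Proof.
case/shortenP=> q rq Uq qp.
have le_qp : size q <= size p by apply: uniq_leq_size qp; case/andP: Uq.
have lt_qT : size q < #|T|.
  by rewrite -[_.+1]/(size (u :: q)) -(card_uniqP Uq) max_card.
have : has_dipath r u (last u q) (size q).
  by apply/existsP; exists (in_tuple q); rewrite rq eqxx Uq.
move/(dist_le_dipath lt_qT); case: (dist _ _ _) => //= m le_mq.
exact: leq_trans le_qp.
Qed.

(** In a cycle, being at distance two means being the second successor, so a
    short chord is determined by its tail. *)
Lemma short_chords_tails e c : uniq c -> cycle e c ->
  #|short_chords e c| <= #|[set x in c | e x (next c (next c x))]|.
Proof.
move=> Uc cP.
have short ab : ab \in short_chords e c ->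
    [/\ ab.1 \in c, e ab.1 ab.2 & ab.2 = next c (next c ab.1)].
  case: ab => a b; rewrite inE => /andP[/and4P[/= eab ac _ _] /eqP/dist_walk].
  case=> p []; case: p => [|m [|b' []]] //= /and3P[am mb _] Eb _.
  rewrite {b'}Eb in mb.
  have nx := circuit_arcs_rel (cycle_next Uc).
  by split=> //; rewrite (eqP (nx _ _ am)) (eqP (nx _ _ mb)).
rewrite -(card_in_imset (f := fst) (D := short_chords e c)); last first.
  move=> [a b] [a' b'] /short[_ _ Eb] /short[_ _ Eb'] /= Ea.
  by rewrite /= in Eb Eb'; rewrite Eb Eb' Ea.
apply/subset_leq_card/subsetP => x /imsetP[ab /short[ac eab abE] ->].
by rewrite inE ac -abE.
Qed.

Lemma next_head x y p : next (x :: y :: p) x = y.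
Proof. by rewrite /= eqxx. Qed.

Lemma next_second x y p : uniq (x :: y :: p) ->
  next (x :: y :: p) y = head x p.
Proof.
move=> Uc; rewrite -(next_rot 1 Uc) rot1_cons rcons_cons.
by case: p Uc => [|z' p] Uc /=; rewrite eqxx.
Qed.

Lemma cycle_shortcut e x y p : 0 < size p ->
  cycle e (x :: y :: p) -> e x (head x p) -> cycle e (x :: p).
Proof. by case: p => //= z p _ /and3P[_ _ zp] ->. Qed.

(** A shortest counterexample is cut into two closed walks at a repeated vertex,
    or else shortened along one or two short chords. *)
Lemma closed_walk_dvd3 e :
  (forall c, circuit e c -> ~~ (3 %| size c) -> 4 <= #|short_chords e c|) ->
  forall c, cycle e c -> 3 %| size c.
Proof.
move=> chords c; have [n] := ubnP (size c); elim: n c => // n IH c lt_cn cP.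
have {IH lt_cn} IH c' : size c' < size c -> cycle e c' -> 3 %| size c'.
  by move=> lt_c'; apply: IH; apply: leq_trans lt_c' _.
have [Uc | /not_uniq_split[x [p1 [p2 [p3 Ec]]]]] := boolP (uniq c); last first.
  have sz_c : size c = size (x :: p2) + size (x :: p3 ++ p1).
    by rewrite Ec !size_cat /= !size_cat /=; lia.
  have : cycle e (x :: p2 ++ x :: p3 ++ p1).
    by rewrite -cat_cons -cat_cons catA -cycle_catC -[_ ++ _]Ec.
  rewrite cycle_split => /andP[/IH d2 /IH d3].
  by rewrite sz_c dvdn_add ?d2 ?d3 // sz_c /=; lia.
apply/negPn/negP => ndvd.
have c0 : c != [::] by apply: contraNneq ndvd => ->.
have := chords c (cycle_circuit c0 cP Uc) ndvd.
move/leq_trans/(_ (short_chords_tails Uc cP)); set S := [set x in c | _] => S4.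
have [x xS] : exists x, x \in S by apply/card_gt0P; lia.
have sz4 : 4 <= size c.
  apply: leq_trans S4 _; rewrite -(card_uniqP Uc).
  by apply/subset_leq_card/subsetP => y; rewrite inE => /andP[].
have inS y : y \in S -> y \in c /\ e y (next c (next c y)).
  by rewrite inE => /andP.
have [xc exx] := inS x xS.
have [i s Ec] := rot_to xc.
have nxt y : next c y = next (x :: s) y by rewrite -Ec next_rot.
have sz_s : size c = (size s).+1 by rewrite -(size_rot i) Ec.
have {cP} cP : cycle e (x :: s) by rewrite -Ec rot_cycle.
have Us : uniq (x :: s) by rewrite -Ec rot_uniq.
have memc y : (y \in c) = (y \in x :: s) by rewrite -Ec mem_rot.
case: s => [|x1 s] in Ec nxt sz_s cP Us memc *; first by rewrite sz_s in sz4.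
rewrite !nxt next_head next_second // in exx.
have s0 : 0 < size s by move: sz4; rewrite sz_s /=; lia.
(* One chord suffices unless the length is 1 modulo 3. *)
have cP1 := cycle_shortcut s0 cP exx.
have {}ndvd : size s = 2 %[mod 3].
  by have := IH (x :: s); rewrite sz_s /= => /(_ (ltnSn _) cP1); lia.
(* The tail of a chord that overlaps the chord at x is x1 or the last vertex. *)
have [y yS yN] : exists2 y, y \in S & y \notin [:: x; x1; last x s].
  apply/subsetPn; apply: contraL S4 => sub; rewrite -ltnNge.
  by rewrite ltnS (leq_trans (subset_leq_card sub)) ?card_size.
have [yc eyy] := inS y yS.
rewrite !in_cons !negb_or in_nil andbT in yN; case/and3P: yN => yx yx1 yl.
have {}ys : y \in s by move: yc; rewrite memc !in_cons (negPf yx) (negPf yx1).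
case/splitPr: ys => p1 p2 in Ec nxt sz_s cP Us memc s0 exx cP1 ndvd yl *.
case: p2 => [|z p2] in Ec nxt sz_s cP Us memc s0 exx cP1 ndvd yl *.
  by rewrite last_cat eqxx in yl.
(* The cycle rotated to start at y, where the second chord can be applied in the
   same way as the first; cP2 is the walk already shortened at x. *)
have Er : rot (size (x :: x1 :: p1)) (x :: x1 :: p1 ++ y :: z :: p2) =
    y :: z :: p2 ++ x :: x1 :: p1 by rewrite -!cat_cons rot_size_cat.
have nxt' v : next c v = next (y :: z :: p2 ++ x :: x1 :: p1) v.
  by rewrite nxt -Er next_rot.
rewrite !nxt' next_head next_second in eyy; last by rewrite -Er rot_uniq.
have cP2 : cycle e (y :: z :: p2 ++ x :: p1).
  by rewrite -!cat_cons cycle_catC in cP1 *.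
have sz2 : 0 < size (p2 ++ x :: p1) by rewrite size_cat addnS.
have eyy' : e y (head y (p2 ++ x :: p1)) by clear -eyy; case: p2 eyy.
have /= := IH (y :: _) _ (cycle_shortcut sz2 cP2 eyy').
move: ndvd; rewrite sz_s /= !size_cat /= !addnS; clear.
by move: (size p1) (size p2) => a b ndvd /(_ ltac:(lia)); lia.
Qed.

Lemma walk_dvd3 r u p : (forall c, cycle r c -> 3 %| size c) ->
  path r u p -> last u p = u -> 3 %| size p.
Proof.
move=> per; case/lastP: p => // p v; rewrite last_rcons => rp Ev.
by rewrite size_rcons; apply: (per (u :: p)); rewrite /= -{2}Ev.
Qed.

(** A walk from their common end back to [u] closes both walks. *)
Lemma walk_mod3 r u p q : (forall c, cycle r c -> 3 %| size c) ->
  strongly_connected r -> path r u p -> path r u q -> last u p = last u q ->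
  size p = size q %[mod 3].
Proof.
move=> per conn rp rq Epq; have /connectP[s rs Eu] := conn (last u p) u.
have := @walk_dvd3 r u (p ++ s) per; have := @walk_dvd3 r u (q ++ s) per.
rewrite !cat_path !last_cat rp rq -Epq rs -Eu !size_cat => /(_ isT erefl) dq.
by move/(_ isT erefl); lia.
Qed.

Lemma closed_walks_dvd3_has_3kernel r (x0 : T) : strongly_connected r ->
  (forall c, cycle r c -> 3 %| size c) -> has_3kernel [set: T] r.
Proof.
move=> conn per.
have /fin_all_exists[w wP] v : exists p, path r x0 p /\ last x0 p = v.
  by have /connectP[p rp ->] := conn x0 v; exists p.
have step u p : path r u p -> size (w (last u p)) = size (w u) + size p %[mod 3].
  move=> rp; have [[ru lu] [rv lv]] := (wP u, wP (last u p)).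
  rewrite -size_cat; apply: (walk_mod3 per conn rv); rewrite ?last_cat ?lu //.
  by rewrite cat_path ru lu.
exists [set v | 3 %| size (w v)]; split=> [|u v|u].
- exact: subsetT.
- rewrite !inE => du dv neq_uv; case Ed: (dist r u v) => [m|] //=.
  have [p [rp lp sz_p]] := dist_walk Ed.
  have := step _ _ rp; rewrite lp sz_p.
  case: m => [|m] in Ed sz_p *; last by lia.
  by case: p lp sz_p {rp} => //= /eqP; rewrite (negPf neq_uv).
- rewrite !inE andbT => ndu.
  have d0 : 3 %| size (w x0) by have [rw lw] := wP x0; apply: walk_dvd3 per rw lw.
  have /connectP[p rp Ep] := conn u x0.
  have := step _ _ rp; rewrite -Ep => sz_p.
  (* Residues increase by 1 along p, which ends at residue 0, so that residue
     occurs within the first two steps. *)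
  have [k [le_k2 le_kp dk]] :
      exists k, [/\ k <= 2, k <= size p & 3 %| size (w u) + k].
    by exists (3 - size (w u) %% 3); split; lia.
  have rk : path r u (take k p) by rewrite take_path.
  have sz_k : size (take k p) = k by rewrite size_takel.
  exists (last u (take k p)); first by rewrite inE; have := step _ _ rk; lia.
  have := dist_le_walk rk; case: (dist _ _ _) => //= m.
  by rewrite sz_k => /leq_trans; apply.
Qed.

End Digraph.

Theorem theorem20 (T : finType) (e : rel T) (loopless : irreflexive e)
    (strong : strongly_connected e) (quasi : quasi_3kernel_perfect e)
    (x0 : T)
    (chords : forall c : seq T, circuit e c -> ~~ (3 %| size c) ->
       4 <= #|short_chords e c|) :
  perfect_3kernel e.
Proof.
move=> A; have [/quasi // | ] := boolP (A \proper [set: T]).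
rewrite properT negbK => /eqP->.
have eE : induced e [set: T] =2 e by move=> x y; rewrite /induced /= !in_setT.
apply: closed_walks_dvd3_has_3kernel x0 _ _ => [u v | c]; first by rewrite (eq_connect eE).
by rewrite (eq_cycle eE); apply: closed_walk_dvd3.
Qed.
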